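(* For every $n\ge 1$, the path $P_n$ is $Q$-unique: if $H$ is a finite simple graph with $Q(H;x,y)=Q(P_n;x,y)$, then $H\cong P_n$.
   Context: For a finite simple graph $G=(V,E)$, the subgraph component polynomial is $Q(G;x,y)=\sum_{X\subseteq V} x^{|X|}y^{k(G[X])}$, where $G[X]$ is the induced subgraph on $X$ and $k(\cdot)$ denotes the number of connected components. $P_n$ is the path on $n$ vertices. *)

(* Defs.v *)
From mathcomp Require Import all_boot all_order all_algebra.
Set Implicit Arguments.
Unset Strict Implicit.
Unset Printing Implicit Defensive.

Import GRing.Theory.

Record sgraph := SGraph {
  vertex :> finType;
  adj : rel vertex;
  adj_sym : symmetric adj;
  adj_irr : irreflexive adj }.

Definition sg_iso (G H : sgraph) : Prop :=
  exists2 f : G -> H, bijective f & forall u v : G, adj (f u) (f v) = adj u v.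

Section Induced.
Variables (G : sgraph) (X : {set G}).

Definition induced_adj : rel {v : G | v \in X} :=
  fun u v => adj (val u) (val v).

Lemma induced_sym : symmetric induced_adj.
Proof. by move=> u v; apply: adj_sym. Qed.

Lemma induced_irr : irreflexive induced_adj.
Proof. by move=> u; apply: adj_irr. Qed.

Definition induced : sgraph := SGraph induced_sym induced_irr.
End Induced.

(* Since adj is symmetric, n_comp counts the classes of connect adj; it is 0
   on the graph with no vertices. *)
Definition ncomponents (G : sgraph) : nat := n_comp (@adj G) G.

(* An element of Z[x, y], with x := 'X and y := 'Y = 'X%:P as in polyXY. *)
Definition subgraph_component_poly (G : sgraph) : {poly {poly int}} :=
  (\sum_(X : {set G}) 'X ^+ #|X| * 'Y ^+ ncomponents (induced X))%R.

Definition Q_unique (G : sgraph) : Prop :=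
  forall H : sgraph,
    subgraph_component_poly H = subgraph_component_poly G -> sg_iso H G.

Section Path.
Variable n : nat.

Definition path_adj : rel 'I_n :=
  fun i j => (i.+1 == j :> nat) || (j.+1 == i :> nat).

Lemma path_adj_sym : symmetric path_adj.
Proof. by move=> i j; rewrite /path_adj orbC. Qed.

Lemma path_adj_irr : irreflexive path_adj.
Proof. by move=> i; rewrite /path_adj orbb gtn_eqF. Qed.

Definition path_graph : sgraph := SGraph path_adj_sym path_adj_irr.
End Path.

(* Main.v *)
Require Import Defs.
From mathcomp Require Import all_boot all_order all_algebra.
From mathcomp Require Import zify.

(** [Q(G; 1, 1) = 2 ^ #|G|] determines the number [n] of vertices, and the
    coefficient of [x ^ k * y] counts the connected induced subgraphs of order
    [k].  Taking [k = n] and [k = n - 1], [H] is connected with at most two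
    non-cut vertices, which forces [H] to be a path.  Indeed let [v] be a
    non-cut vertex of [H].  A non-cut vertex of [H - v] that is a cut vertex of
    [H] has to be the only neighbour of [v].  Hence [H - v] again has at most
    two non-cut vertices and is a path by induction.  Its two ends and [v]
    cannot all be non-cut vertices of [H], so [v] is a pendant vertex attached
    to an end of the path. *)

Set Implicit Arguments.
Unset Strict Implicit.
Unset Printing Implicit Defensive.

Import GRing.Theory Num.Theory.

(** * Connected vertex sets *)

Section Connectedness.
Variable G : sgraph.
Implicit Types (X A : {set G}) (u v w : G) (s : seq G).

Definition connected X := ncomponents (induced X) == 1.

(** Rephrases connectedness inside [G] by adjacency-closed subsets, so that later arguments never
    handle the subtype [induced X]. *)
Lemma connectedP X :
  reflect (X != set0 /\ forall A, A \subset X -> A != set0 ->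
             (forall u v, u \in A -> v \in X -> adj u v -> v \in A) -> A = X)
          (connected X).
Proof.
have symc : connect_sym (@adj (induced X)).
  by apply: sym_connect_sym; apply: adj_sym.
apply: (iffP idP) => [|[]].
  (* [n_comp] counts component roots, so a count of one gives a single root [r] common to all
     vertices. *)
  move=> /eqP /mem_card1 [r Er].
  have rootr x : fingraph.root (@adj (induced X)) x = r.
    by apply/eqP; rewrite -[_ == _]Er inE /= roots_root.
  split=> [|A sAX /set0Pn [a Aa] clA].
    by apply/set0Pn; exists (val r); apply: valP.
  apply/eqP; rewrite eqEsubset sAX; apply/subsetP=> x Xx.
  have clA' : closed (@adj (induced X)) [pred z : induced X | val z \in A].
    apply: intro_closed => // y z yz; rewrite !inE => Ay.
    by apply: clA yz => //; apply: valP.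
  pose a' : induced X := Sub a (subsetP sAX a Aa).
  pose x' : induced X := Sub x Xx.
  have /(closed_connect clA') : connect (@adj (induced X)) a' x'.
    by rewrite -root_connect // !rootr.
  by rewrite !inE /= Aa => <-.
move=> /set0Pn [x Xx] cutX.
pose x' : induced X := Sub x Xx.
pose A := [set val z | z in connect (@adj (induced X)) x'].
have AX : A = X.
  apply: cutX.
  - by apply/subsetP=> _ /imsetP [z _ ->]; apply: valP.
  - by apply/set0Pn; exists x; apply/imsetP; exists x' => //; apply: connect0.
  - move=> u v /imsetP [z xz ->] Xv zv; apply/imsetP.
    exists (Sub v Xv : induced X) => //.
    by apply: connect_trans xz _; apply: connect1.
rewrite /connected /ncomponents.
rewrite -(@eq_n_comp_r _ _ (connect (@adj (induced X)) x')) ?n_comp_connect //.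
move=> z; rewrite [RHS]inE.
have : val z \in A by rewrite AX; apply: valP.
by case/imsetP=> z' xz' /val_inj ->.
Qed.

Lemma connected_neq0 X : connected X -> X != set0.
Proof. by case/connectedP. Qed.

Lemma connected1 v : connected [set v].
Proof.
apply/connectedP; split=> [|A]; first by apply/set0Pn; exists v; rewrite set11.
by rewrite subset1 => /orP [/eqP ->|/eqP ->] //; rewrite eqxx.
Qed.

(** A nonempty closed set either misses [X], hence contains [v] and then [u], which is absurd, or
    contains all of [X] and then [v], by the edge [u v]. *)
Lemma connectedU1 X u v :
  connected X -> u \in X -> adj u v -> connected (v |: X).
Proof.
move=> /connectedP [_ cutX] Xu uv; apply/connectedP; split=> [|A sA A0 clA].
  by apply/set0Pn; exists v; rewrite setU11.
have [AX0|AX0] := eqVneq (A :&: X) set0.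
  have notA w : w \in X -> w \notin A.
    by move=> Xw; apply/negP=> Aw; have := in_set0 w; rewrite -AX0 inE Aw Xw.
  case/set0Pn: A0 => w Aw; have := subsetP sA w Aw.
  case/setU1P=> [Ew|Xw]; last by have := notA w Xw; rewrite Aw.
  rewrite {}Ew in Aw.
  by case/negP: (notA u Xu); apply: (clA v) => //; rewrite ?setU1r // adj_sym.
have EX : A :&: X = X.
  apply: cutX => //; first exact: subsetIr.
  move=> a b /setIP [Aa _] Xb ab; rewrite inE Xb andbT.
  by apply: clA ab => //; rewrite setU1r.
have sXA : X \subset A by rewrite -EX subsetIl.
apply/eqP; rewrite eqEsubset sA subUset sXA sub1set andbT.
by apply: (clA u); rewrite ?setU11 // (subsetP sXA).
Qed.

(** Without such a neighbour, [[set v]] would be closed and so equal to [X]. *)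
Lemma connected_nbr X v : connected X -> v \in X -> 1 < #|X| ->
  exists2 u, u \in X :\ v & adj u v.
Proof.
move=> /connectedP [_ cutX] Xv cX; apply/exists_inP; apply: contraT => noadj.
have E : [set v] = X.
  apply: cutX; rewrite ?sub1set //.
    by apply/set0Pn; exists v; rewrite set11.
  move=> _ u /set1P -> Xu vu; apply/negPn/negP; rewrite inE => uv.
  by case/negP: noadj; apply/exists_inP; exists u; rewrite ?inE ?uv // adj_sym.
by rewrite -E cards1 in cX.
Qed.

(* A maximal connected proper subset [A] of [X] misses a single vertex, since
   adding to [A] a neighbour of [A] exhausts [X]. *)
Lemma connected_noncut X : connected X -> 1 < #|X| ->
  exists2 v, v \in X & connected (X :\ v).
Proof.
move=> cX X1; have /connectedP [/set0Pn [x Xx] cutX] := cX.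
pose P A := (A \proper X) && connected A.
have P1 : P [set x].
  by rewrite /P connected1 properEcard sub1set Xx cards1 X1.
have [A /maxsetP [/andP [pA cA] maxA] _] := @maxset_exists _ P _ P1.
have [sAX nXA] := andP pA.
have [/existsP [u /existsP [v /and4P [Au Xv uv nAv]]]|noadj] :=
  boolP [exists u, exists v, [&& u \in A, v \in X, adj u v & v \notin A]].
  have cvA := connectedU1 cA Au uv.
  have EX : v |: A = X.
    apply/eqP; apply: contraT => nE.
    have /maxA H : P (v |: A).
      by rewrite /P cvA properEneq nE subUset sub1set Xv sAX.
    by rewrite -(H (subsetUr _ _)) setU11 in nAv.
  by exists v => //; rewrite -EX setU1K.
case/negP: nXA; rewrite (cutX A) ?connected_neq0 // => u v Au Xv uv.
apply: contraNT noadj => nAv; apply/existsP; exists u; apply/existsP; exists v.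
exact/and4P.
Qed.

(** * Non-cut vertices and induced paths *)

Definition noncut X := [set v in X | connected (X :\ v)].

(** A neighbour of [v] other than [w] would attach [v] to the connected set [X :\ v :\ w], making
    [X :\ w] connected. *)
Lemma noncut_pendant X v w u : v \in noncut X -> w \in noncut (X :\ v) ->
  w \notin noncut X -> u \in X -> adj u v -> u = w.
Proof.
rewrite !inE => /andP [Xv cXv] /andP [/andP [wv Xw] cXvw].
rewrite Xw /= => ncXw Xu uv; apply/eqP; apply: contraNT ncXw => nuw.
have -> : X :\ w = v |: (X :\ v :\ w).
  apply/setP=> z; rewrite !inE.
  by have [->|] := eqVneq z v; rewrite //= Xv andbT eq_sym.
apply: (connectedU1 cXvw _ uv); rewrite !inE nuw Xu andbT /=.
by apply/eqP=> E; rewrite E adj_irr in uv.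
Qed.

Definition induced_path s := uniq s /\
  forall x0 i j, i < size s -> j < size s ->
    adj (nth x0 s i) (nth x0 s j) = (i.+1 == j) || (j.+1 == i).

Lemma induced_path1 v : induced_path [:: v].
Proof. by split=> // x0 [|i] [|j] //=; rewrite adj_irr. Qed.

Lemma induced_path_rev s : induced_path s -> induced_path (rev s).
Proof.
case=> us adjs; split=> [|x0 i j]; rewrite ?rev_uniq // size_rev => lti ltj.
rewrite !nth_rev // adjs; lia.
Qed.

Lemma induced_path_behead v s : induced_path (v :: s) -> induced_path s.
Proof.
case=> /= /andP [_ us] adjs; split=> // x0 i j lti ltj.
exact: (adjs x0 i.+1 j.+1).
Qed.

Lemma induced_path_cons v w s : induced_path (w :: s) -> v \notin w :: s ->
    adj w v -> (forall u, u \in w :: s -> adj u v -> u = w) ->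
  induced_path (v :: w :: s).
Proof.
case=> us adjs vs wv onlyw; split=> [|x0 i j]; first by rewrite cons_uniq vs.
have adjv k : k < size (w :: s) -> adj (nth x0 (w :: s) k) v = (k == 0).
  move=> ltk; apply/idP/eqP=> [kv|-> //].
  have /eqP := onlyw _ (mem_nth x0 ltk) kv.
  by rewrite -[X in _ == X]/(nth x0 (w :: s) 0) nth_uniq // => /eqP.
case: i j => [|i] [|j] lti ltj.
- by rewrite /= adj_irr.
- by rewrite [LHS]adj_sym [LHS]adjv // orbF eqSS eq_sym.
- by rewrite [LHS]adjv // eqSS eq_sym.
- exact: (adjs x0 i j).
Qed.

Lemma induced_path_connected s :
  induced_path s -> s != [::] -> connected [set x in s].
Proof.
elim: s => [//|a [|b s] IHs] ps _; rewrite set_cons.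
  have -> : [set x in [::]] = set0 :> {set G} by apply/setP=> x; rewrite !inE.
  by rewrite setU0 connected1.
apply: (@connectedU1 _ b); last by rewrite (ps.2 a 1 0).
  by apply: IHs => //; apply: induced_path_behead ps.
by rewrite !inE eqxx.
Qed.

Lemma induced_path_noncut v s :
  induced_path (v :: s) -> s != [::] -> v \in noncut [set x in v :: s].
Proof.
move=> ps s0; have [/= /andP [vs _] _] := ps.
rewrite inE set_cons setU11 setU1K ?inE //.
by apply: induced_path_connected => //; apply: induced_path_behead ps.
Qed.

(** Removing [v] loses the non-cut vertex [v] and creates at most one new one, since a new one must
    be the only neighbour of [v]. *)
Lemma noncut_setD1 X v : connected X -> v \in noncut X -> 1 < #|X| ->
  #|noncut (X :\ v)| <= #|noncut X|.
Proof.
move=> cX ncv X1; have Xv : v \in X by move: ncv; rewrite inE => /andP [].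
have sN u : u \in noncut (X :\ v) -> u \in noncut X -> u \in noncut X :\ v.
  move=> ncu ncXu; move: ncu.
  by rewrite !in_setD1 ncXu inE => /andP [/setD1P [->]].
rewrite (cardsD1 v (noncut X)) ncv.
have [/subsetP sub|/subsetPn [w ncw ncXw]] :=
  boolP (noncut (X :\ v) \subset noncut X).
  by apply/leqW/subset_leq_card/subsetP => u ncu; apply: sN (sub _ _).
apply: (@leq_trans #|w |: (noncut X :\ v)|); last first.
  by rewrite cardsU1 leq_add2r leq_b1.
apply/subset_leq_card/subsetP=> u ncu; have [ncXu|ncXu] := boolP (u \in noncut X).
  by rewrite setU1r // sN.
have [z /setD1P [_ Xz] zv] := connected_nbr cX Xv X1.
rewrite -(noncut_pendant ncv ncu ncXu Xz zv).
by rewrite (noncut_pendant ncv ncw ncXw Xz zv) setU11.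
Qed.

Lemma noncut_path X : connected X -> #|noncut X| <= 2 ->
  exists2 s, induced_path s & X = [set x in s].
Proof.
have [m] := ubnP #|X|; elim: m X => // m IHm X leXm cX nc2.
have [X1|X1] := leqP #|X| 1.
  have /cards1P [x ->] : #|X| == 1.
    by rewrite eqn_leq X1 card_gt0 connected_neq0.
  by exists [:: x]; [apply: induced_path1 | apply/setP=> y; rewrite !inE].
have [v Xv cXv] := connected_noncut cX X1.
have ncv : v \in noncut X by rewrite inE Xv.
have [||s ps EX] := IHm (X :\ v) _ cXv.
- by rewrite (cardsD1 v X) Xv in leXm.
- exact: leq_trans (noncut_setD1 cX ncv X1) nc2.
have nbrs u : u \in X -> adj u v -> u \in s.
  move=> Xu uv; have : u \in X :\ v.
    by rewrite in_setD1 Xu andbT; apply: contraTneq uv => ->; rewrite adj_irr.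
  by rewrite EX inE.
(* [w :: t] is [s] or its reversal, oriented so that [v] attaches at the head; hence only [=i]. *)
have [w [t [pt Et onlyw]]] :
    exists w t, [/\ induced_path (w :: t), w :: t =i s & forall u, u \in X -> adj u v -> u = w].
  case: s => [|a [|b s]] in ps EX nbrs *.
  - case/connected_neq0/negP: cXv; rewrite EX.
    by apply/eqP/setP=> x; rewrite !inE.
  - by exists a, [::]; split=> // u Xu /(nbrs u Xu); rewrite inE => /eqP.
  (* If the end [a] is a cut vertex of [X], then [v] hangs on [a]; otherwise the path is reversed to
     use its other end. *)
  have [ncXa|ncXa] := boolP (a \in noncut X); last first.
    exists a, (b :: s); split=> // u; apply: (noncut_pendant ncv) => //.
    by rewrite EX induced_path_noncut.
  have Erev : rev (a :: b :: s) = last b s :: rev (belast a (b :: s)).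
    by rewrite lastI rev_rcons.
  have prev := induced_path_rev ps; rewrite Erev in prev.
  have memrev : last b s :: rev (belast a (b :: s)) =i a :: b :: s.
    by move=> x; rewrite -Erev mem_rev.
  exists (last b s), (rev (belast a (b :: s))); split=> // u.
  have ncz : last b s \in noncut (X :\ v).
    have -> : X :\ v = [set x in last b s :: rev (belast a (b :: s))].
      by rewrite EX; apply/setP=> x; rewrite [LHS]inE [RHS]inE memrev.
    by rewrite induced_path_noncut // -size_eq0 size_rev size_belast.
  (* Were the other end also non-cut in [X], both ends and [v] would be three distinct non-cut
     vertices. *)
  apply: (noncut_pendant ncv ncz); apply/negP=> ncXz.
  have az : last b s != a.
    case: ps => /= /andP [abs _] _.
    by apply: contraNneq abs => <-; apply: mem_last.
  have [va vz] : a != v /\ last b s != v.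
    have Y x : x \in a :: b :: s -> x != v.
      move=> sx; have : x \in X :\ v by rewrite EX inE.
      by case/setD1P.
    by split; apply: Y; rewrite ?mem_head // in_cons mem_last orbT.
  have /subset_leq_card : v |: [set a; last b s] \subset noncut X.
    by rewrite !subUset !sub1set ncv ncXa.
  rewrite cardsU1 cards2 !inE negb_or eq_sym va eq_sym vz eq_sym az.
  by move/leq_trans/(_ nc2).
exists (v :: w :: t).
  apply: induced_path_cons => //.
  - by rewrite Et; have := setD11 v X; rewrite EX inE => ->.
  - have [u /setD1P [_ Xu] uv] := connected_nbr cX Xv X1.
    by rewrite -(onlyw u Xu uv).
  - move=> u tu; apply: onlyw; suff /setD1P [] : u \in X :\ v by [].
    by rewrite EX inE -Et.
rewrite set_cons -(setD1K Xv) EX; congr (_ |: _).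
by apply/setP=> u; rewrite !inE -Et inE.
Qed.

End Connectedness.

(** * Data read off from the polynomial *)

Lemma horner_subgraph_component_poly (G : sgraph) :
  ((subgraph_component_poly G).[1].[1] = (2 ^ #|G|)%:R)%R.
Proof.
rewrite /subgraph_component_poly horner_sum horner_sum.
under eq_bigr => X _ do
  rewrite hornerM hornerXn -polyC_exp hornerC expr1n mul1r hornerXn expr1n.
by rewrite sumr_const -[#|G|]cardsT -card_powerset powersetT cardsT.
Qed.

(** The outer index is the exponent of [x], the inner one that of [y]. *)
Lemma coef_subgraph_component_poly (G : sgraph) k :
  ((subgraph_component_poly G)`_k`_1 =
    #|[set X : {set G} | (#|X| == k) && connected X]|%:R)%R.
Proof.
rewrite /subgraph_component_poly coef_sum coef_sum -sum1_card natr_sum.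
rewrite [RHS]big_mkcond /=; apply: eq_bigr => X _.
rewrite -polyC_exp mulrC coefCM coefXn inE eq_sym.
case: eqP => _ /=; last by rewrite mulr0 coef0.
by rewrite mulr1 coefXn /connected eq_sym; case: eqP.
Qed.

(** * The path graph *)

Lemma leq_noncut_path m : #|[set X : {set path_graph m.+1} |
  (#|X| == m) && connected X]| <= 2.
Proof.
apply: (@leq_trans #|[set [set~ ord0 : path_graph m.+1]; [set~ ord_max]]|).
  apply/subset_leq_card/subsetP=> X; rewrite inE => /andP [/eqP cardX cX].
  have /eqP/cards1P [v Ev] : #|~: X| = 1.
    by have := cardsC X; rewrite card_ord cardX; lia.
  have {Ev} EX : X = [set~ v] by rewrite -[X]setCK Ev.
  apply: contraT; rewrite EX !inE => nv.
  have [v0 vm] : v != ord0 /\ v != ord_max.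
    by split; apply: contraNneq nv => ->; rewrite eqxx ?orbT.
  have /connectedP [_ cutX] := cX.
  have lt0v : 0 < v.
    by rewrite lt0n; apply: contra v0 => /eqP v0; apply/eqP/val_inj.
  have ltvm : v < m.
    rewrite ltn_neqAle -ltnS ltn_ord andbT.
    by apply: contra vm => /eqP vm; apply/eqP/val_inj.
  (* When an inner vertex [v] is deleted, no edge leads from below [v] to above it, so the part
     below is closed; yet it misses [ord_max]. *)
  have E : [set i : path_graph m.+1 | i < v] = X.
    apply: cutX.
    - apply/subsetP=> i; rewrite EX !inE => ltiv.
      by apply: contraTneq ltiv => ->; rewrite ltnn.
    - by apply/set0Pn; exists ord0; rewrite inE.
    - move=> i j; rewrite EX !inE => ltiv.
      rewrite -(inj_eq val_inj) /= /path_adj => jv; lia.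
  have : (ord_max : path_graph m.+1) \in X by rewrite EX !inE eq_sym.
  by rewrite -E inE /= ltnNge ltnW.
by rewrite cards2; case: eqP.
Qed.

Lemma path_graph_connected m : connected [set: path_graph m.+1].
Proof.
have -> : [set: path_graph m.+1] = [set x in enum 'I_m.+1].
  by apply/setP=> i; rewrite !inE mem_enum.
apply: induced_path_connected; last by rewrite -size_eq0 size_enum_ord.
split=> [|i0 i j]; rewrite ?enum_uniq // size_enum_ord => lti ltj.
by rewrite /adj /= /path_adj !nth_enum_ord.
Qed.

(** The isomorphism sends each vertex to its position in [s]. *)
Lemma induced_path_iso (G : sgraph) (s : seq G) n : #|G| = n ->
  induced_path s -> [set: G] = [set x in s] -> sg_iso G (path_graph n).
Proof.
move=> cardG [us adjs] Es.
have ins x : x \in s by have := in_setT x; rewrite Es inE.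
have size_s : size s = n.
  by rewrite -(card_uniqP us) -cardG; apply: eq_card => x; rewrite ins.
have lt_index x : index x s < n by rewrite -size_s index_mem.
exists (fun x => Ordinal (lt_index x) : path_graph n).
  apply: inj_card_bij; last by rewrite card_ord cardG.
  by move=> x y [Exy]; rewrite -(nth_index x (ins x)) Exy nth_index.
move=> x y.
rewrite -[in RHS](nth_index x (ins x)) -[in RHS](nth_index x (ins y)).
by rewrite adjs ?index_mem.
Qed.

(** * Uniqueness of the path *)

Theorem theorem4p3 (n : nat) (hn : 1 <= n) : Q_unique (path_graph n).
Proof.
case: n hn => // m _ H EQ.
have cardH : #|H| = m.+1.
  have := horner_subgraph_component_poly H.
  rewrite EQ horner_subgraph_component_poly card_ord => /eqP.
  by rewrite eqr_nat eqn_exp2l // => /eqP.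
have same_count k : #|[set X : {set H} | (#|X| == k) && connected X]| =
    #|[set X : {set path_graph m.+1} | (#|X| == k) && connected X]|.
  by apply/eqP; rewrite -(eqr_nat int) -!coef_subgraph_component_poly EQ.
have connH : connected [set: H].
  (* The full vertex set of the path is counted for [k = m.+1]; in [H] only [setT] has that
     order. *)
  have : 0 < #|[set X : {set H} | (#|X| == m.+1) && connected X]|.
    rewrite same_count; apply/card_gt0P; exists setT.
    by rewrite inE cardsT card_ord eqxx path_graph_connected.
  case/card_gt0P=> X; rewrite inE -cardH => /andP [/eqP cardX].
  suff -> : X = setT by [].
  by apply/eqP; rewrite eqEcard subsetT cardsT cardX leqnn.
have [|s ps Es] := noncut_path connH; last exact: induced_path_iso ps Es.
apply: leq_trans (leq_noncut_path m); rewrite -same_count.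
(* Taking complements injects the non-cut vertices of [H] into its connected sets of order [m]. *)
have setC1_inj : injective (fun v : H => [set~ v]).
  by move=> u v /setC_inj /set1_inj.
rewrite -(card_imset _ setC1_inj).
apply/subset_leq_card/subsetP=> _ /imsetP [v ncv ->].
have /setIdP [_ cv] := ncv.
by rewrite inE cardsC1 cardH eqxx -setTD.
Qed.
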